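(* Let $(V, \varphi)$ be a linear representation of a finite gyrogroup $G$ over a field $\mathbb{F}$. If $\mathrm{char}\,\mathbb{F} = 0$ or $\mathrm{char}\,\mathbb{F}$ does not divide $|G|$, then for any invariant subspace $U$ of $V$, there exists an invariant subspace $W$ of $V$ such that $V = U\oplus W$ (internal direct sum of subspaces).
   Context: A gyrogroup is a nonempty set $G$ with a binary operation $\oplus$ such that: (G1) there is an element $e\in G$ with $e\oplus a=a$ for all $a\in G$; (G2) for each $a\in G$ there is $b\in G$ with $b\oplus a=e$; (G3) for all $a,b\in G$ there is an automorphism $\mathrm{gyr}[a,b]$ of $(G,\oplus)$ (a bijection of $G$ preserving $\oplus$) such that $a\oplus(b\oplus c)=(a\oplus b)\oplus \mathrm{gyr}[a,b]c$ for all $c\in G$; (G4) $\mathrm{gyr}[a\oplus b,b]=\mathrm{gyr}[a,b]$ for all $a,b\in G$. In any gyrogroup, $e$ is the unique two-sided identity and each $a$ has a unique two-sided inverse, denoted $\ominus a$. Let $V$ be a vector space (not necessarily finite-dimensional) over a field $\mathbb{F}$ and $\mathrm{GL}(V)$ the group of linear automorphisms of $V$. A linear representation of $G$ on $V$, denoted $(V,\varphi)$, is a map $\varphi\colon G\to \mathrm{GL}(V)$ with $\varphi(a\oplus b)=\varphi(a)\circ\varphi(b)$ for all $a,b\in G$. A subspace $U$ of $V$ is invariant if $\varphi(a)(U)\subseteq U$ for all $a\in G$. *)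

(* Defs.v *)
From HB Require Import structures.
From mathcomp Require Import all_boot all_order all_algebra.
From mathcomp Require Import boolp classical_sets.

Set Implicit Arguments.
Unset Strict Implicit.
Unset Printing Implicit Defensive.

Import GRing.Theory.
Local Open Scope ring_scope.
Local Open Scope classical_set_scope.

(* [gyrzero] and [gyr] are data rather than existentially quantified, but both
   are determined by [gyradd]: a gyrogroup has only one left identity, and left
   cancellation makes the automorphism in [gyraddA] unique. *)
HB.mixin Record isGyrogroup G := {
  gyradd : G -> G -> G;
  gyrzero : G;
  gyr : G -> G -> G -> G;
  gyradd0l : forall a : G, gyradd gyrzero a = a;
  gyraddNl_ex : forall a : G, exists b : G, gyradd b a = gyrzero;
  gyr_bij : forall a b : G, bijective (gyr a b);
  gyr_morph : forall a b : G, {morph gyr a b : c d / gyradd c d};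
  gyraddA : forall a b c : G,
    gyradd a (gyradd b c) = gyradd (gyradd a b) (gyr a b c);
  gyr_loop : forall a b : G, gyr (gyradd a b) b = gyr a b
}.

#[short(type="gyrogroupType")]
HB.structure Definition Gyrogroup := {G of isGyrogroup G}.

#[short(type="finGyrogroupType")]
HB.structure Definition FinGyrogroup := {G of isGyrogroup G & Finite G}.

Record linear_automorphism (F : fieldType) (V : lmodType F) := LinearAutomorphism {
  linear_automorphism_fun :> {linear V -> V};
  linear_automorphism_bij : bijective linear_automorphism_fun
}.

Notation "''GL' ( V )" := (linear_automorphism V)
  (at level 8, format "''GL' ( V )") : type_scope.

Record gyro_repr (F : fieldType) (G : gyrogroupType) (V : lmodType F) :=
  GyroRepr {
  gyro_repr_fun :> G -> 'GL(V);
  gyro_reprD : forall a b : G,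
    gyro_repr_fun (gyradd a b) =1 gyro_repr_fun a \o gyro_repr_fun b
}.

Definition subspace (F : fieldType) (V : lmodType F) (U : set V) : Prop :=
  GRing.submod_closed [in U].

Definition invariant_subspace (F : fieldType) (G : gyrogroupType)
    (V : lmodType F) (phi : gyro_repr G V) (U : set V) : Prop :=
  subspace U /\ forall a : G, phi a @` U `<=` U.

Definition internal_direct_sum (F : fieldType) (V : lmodType F)
    (U W : set V) : Prop :=
  [set u + w | u in U & w in W] = [set: V] /\ U `&` W = [set 0].

(* Main.v *)
(** Maschke's averaging argument.  Pick any linear projection [p] of [V] onto
    [U] and average its conjugates [phi a \o p \o (phi a)^-1] over [G]; the
    kernel of the average is the required complement.  That [G] is not
    associative does no harm: [phi] takes values in an honest group, and all
    that is needed of [G] is that left translations are permutations, so that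
    the sum can be reindexed. *)
Require Import Defs.
From HB Require Import structures.
From mathcomp Require Import all_boot all_order all_algebra.
From mathcomp Require Import boolp classical_sets.

Set Implicit Arguments.
Unset Strict Implicit.
Unset Printing Implicit Defensive.

Import GRing.Theory.

Section Subspace.
Local Open Scope ring_scope.
Local Open Scope classical_set_scope.
Variables (F : fieldType) (V : lmodType F).
Implicit Types U W : set V.

Lemma subspaceP U :
  subspace U <-> U 0 /\ forall a u v, U u -> U v -> U (a *: u + v).
Proof.
split=> -[U0 Ulin]; split.
- by move: U0; rewrite inE.
- by move=> a u v uU vU; apply/set_mem/Ulin; apply/mem_set.
- exact/mem_set.
- by move=> a u v /set_mem uU /set_mem vU; apply/mem_set/Ulin.
Qed.

Lemma subspace0 U : subspace U -> U 0.
Proof. by case/subspaceP. Qed.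

Lemma subspaceZ U a u : subspace U -> U u -> U (a *: u).
Proof.
by case/subspaceP=> U0 Ulin uU; rewrite -[a *: u]addr0; apply: Ulin.
Qed.

Lemma subspaceD U u v : subspace U -> U u -> U v -> U (u + v).
Proof.
by case/subspaceP=> _ Ulin uU vU; rewrite -[u]scale1r; apply: Ulin.
Qed.

Lemma subspaceB U u v : subspace U -> U u -> U v -> U (u - v).
Proof.
move=> Usub uU vU; apply: subspaceD => //.
by rewrite -scaleN1r; apply: subspaceZ.
Qed.

Lemma subspace_sum U (I : finType) (f : I -> V) :
  subspace U -> (forall i, U (f i)) -> U (\sum_i f i).
Proof.
move=> Usub fU; apply: (big_ind U) => //; first exact: subspace0.
by move=> u v; apply: subspaceD.
Qed.

(** Zorn's lemma gives a maximal [W] among the sets closed under linear combinations that meet [U]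
    in at most 0. A vector outside [U + W] could be adjoined to [W], against maximality. *)
Lemma subspace_complement U :
  subspace U -> exists2 W, subspace W & internal_direct_sum U W.
Proof.
move=> Usub.
(* Not requiring [0] makes the empty chain harmless in Zorn's lemma. *)
pose indep W := (forall a u v, W u -> W v -> W (a *: u + v)) /\
                (forall w, U w -> W w -> w = 0).
have [|W [Wind Wmax]] := @Zorn_bigcup V indep.
  move=> C Cind Ctot; split=> [a u v [X CX Xu] [Y CY Yv]|w Uw [X CX Xw]].
    have [XY|YX] := Ctot X Y CX CY.
      by exists Y => //; apply: (Cind Y CY).1 => //; apply: XY.
    by exists X => //; apply: (Cind X CX).1 => //; apply: YX.
  exact: (Cind X CX).2.
have [Wlin WU0] := Wind.
have W0 : W 0.
  (* A nonempty [W] contains [-1 *: w + w = 0]; an empty one would be strictly below the admissible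
     set [[set 0]]. *)
  apply: contrapT => W0.
  have Wempty w : ~ W w.
    by move=> Ww; apply: W0; rewrite -(addNr w) -scaleN1r; apply: Wlin.
  apply: (Wmax [set 0]).
    by split=> [w /Wempty|/(_ 0 erefl)].
  by split=> [a u v -> ->|//]; rewrite scaler0 addr0.
have Wsub : subspace W by apply/subspaceP.
exists W => //; split; last first.
  apply/seteqP; split=> [w [Uw Ww]|w ->]; first exact: WU0.
  by split; [apply: subspace0|].
apply/seteqP; split=> // v _; apply: contrapT => vUW.
pose B := [set x | exists a, exists2 w, W w & x = a *: v + w].
have WB : W `<=` B by move=> w Ww; exists 0, w => //; rewrite scale0r add0r.
apply: (Wmax B).
  split=> // BW; apply: vUW; exists 0; first exact: subspace0.
  exists v; last by rewrite add0r.
  by apply: BW; exists 1, 0 => //; rewrite scale1r addr0.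
split=> [c _ _ [a [w Ww ->]] [b [x Wx ->]]|y Uy [a [w Ww yE]]].
  exists (c * a + b), (c *: w + x); first exact: Wlin.
  by rewrite scalerDr scalerA scalerDl addrACA.
(* For [a != 0], an equation [y = a *: v + w] with [y] in [U] can be solved for [v], which puts [v]
   in [U + W]. *)
have [a0|a0] := eqVneq a 0.
  by apply: WU0 => //; rewrite yE a0 scale0r add0r.
case: vUW; exists (a^-1 *: y); first exact: subspaceZ.
exists (- a^-1 *: w); first exact: subspaceZ.
by rewrite yE scalerDr scalerA mulVf// scale1r scaleNr addrK.
Qed.

Lemma subspace_projection U : subspace U ->
  exists p : V -> V, [/\ linear p, forall v, U (p v) & forall u, U u -> p u = u].
Proof.
move=> Usub; have [W Wsub [UW UW0]] := subspace_complement Usub.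
have pex v : exists u, U u /\ W (v - u).
  have : [set: V] v by [].
  by rewrite -UW => -[u Uu [w Ww <-]]; exists u; split=> //; rewrite addrC addKr.
have [p pP] := choice pex.
(* The [U]-component is unique because [U] and [W] meet only in 0; linearity of the chosen [p]
   follows from this. *)
have p_uniq v u : U u -> W (v - u) -> p v = u.
  move=> Uu Wvu; apply/subr0_eq.
  suff : [set 0] (p v - u) by [].
  rewrite -UW0; split; first by apply: subspaceB => //; apply: (pP v).1.
  have -> : p v - u = (v - u) - (v - p v).
    by rewrite opprB [RHS]addrC addrA subrK.
  by apply: subspaceB => //; apply: (pP v).2.
exists p; split=> [a u v|v|u Uu].
- have [Upu Wpu] := pP u; have [Upv Wpv] := pP v.
  apply: p_uniq; first by apply: subspaceD => //; apply: subspaceZ.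
  by rewrite opprD addrACA -scalerBr; apply: subspaceD => //; apply: subspaceZ.
- exact: (pP v).1.
- by apply: p_uniq => //; rewrite subrr; apply: subspace0.
Qed.

End Subspace.

(** Adding a left inverse [b] of [a] on the left turns [gyradd a c] into [gyr b a c], and [gyr b a]
    is injective. *)
Lemma gyradd_inj (G : gyrogroupType) (a : G) : injective (gyradd a).
Proof.
move=> c d acd; have [b ba] := gyraddNl_ex a.
apply: (bij_inj (gyr_bij b a)).
by rewrite -[LHS]gyradd0l -[RHS]gyradd0l -ba -!gyraddA acd.
Qed.

Section Representation.
Local Open Scope ring_scope.
Local Open Scope classical_set_scope.
Variables (F : fieldType) (G : gyrogroupType) (V : lmodType F).
Variable phi : gyro_repr G V.

Lemma gyro_repr_inj a : injective (phi a).
Proof. exact: bij_inj (linear_automorphism_bij (phi a)). Qed.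

Lemma gyro_repr0 v : phi (gyrzero : G) v = v.
Proof.
apply: (@gyro_repr_inj gyrzero).
by have /= <- := gyro_reprD phi gyrzero gyrzero v; rewrite gyradd0l.
Qed.

(** A left inverse in [G] gives one cancellation; injectivity of [phi (inv a)] gives the other. *)
Lemma gyro_repr_inverse :
  exists inv : G -> G, forall a, cancel (phi a) (phi (inv a)) /\
                               cancel (phi (inv a)) (phi a).
Proof.
have [inv invP] := choice (@gyraddNl_ex G); exists inv => a.
have invK : cancel (phi a) (phi (inv a)).
  move=> v; have /= <- := gyro_reprD phi (inv a) a v.
  by rewrite invP gyro_repr0.
by split=> // v; apply: (@gyro_repr_inj (inv a)); rewrite invK.
Qed.

End Representation.

Lemma pchar_natr_neq0 (F : fieldType) (n : nat) : (0 < n)%N ->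
  [pchar F]%R =i pred0 \/
    (exists p : nat, p \in [pchar F]%R /\ ~~ (p %| n)%N) ->
  (n%:R != 0 :> F)%R.
Proof.
move=> n_gt0 [/pcharf0P->|[p [pF pn]]]; first by rewrite -lt0n.
by rewrite -(dvdn_pcharf pF).
Qed.

Theorem theorem3p2 (F : fieldType) (G : finGyrogroupType) (V : lmodType F)
    (phi : gyro_repr G V)
    (charFG : [pchar F]%R =i pred0 \/
              exists p : nat, p \in [pchar F]%R /\ ~~ (p %| #|G|))
    (U : set V) (invU : invariant_subspace phi U) :
  exists W : set V, invariant_subspace phi W /\ internal_direct_sum U W.
Proof.
have [Usub phiU] := invU.
have UG a v : U v -> U (phi a v) by move=> Uv; apply: (phiU a); exists v.
have n0 : (#|G|%:R != 0 :> F)%R.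
  by apply: pchar_natr_neq0 => //; apply/card_gt0P; exists gyrzero.
have [p [plin pU pid]] := subspace_projection Usub.
have [inv invP] := gyro_repr_inverse phi.
have phiK a := (invP a).1; have phiKV a := (invP a).2.
pose q v := (#|G|%:R^-1 *: \sum_(a : G) phi a (p (phi (inv a) v)))%R.
have qlin : linear q.
  move=> c u v; rewrite /q scalerA mulrC -scalerA -scalerDr; congr (_ *: _)%R.
  rewrite scaler_sumr -big_split; apply: eq_bigr => a _ /=.
  by rewrite linearP plin linearP.
have qU v : U (q v).
  by apply: subspaceZ => //; apply: subspace_sum => // a; apply/UG/pU.
have qid u : U u -> q u = u.
  move=> Uu; rewrite /q (eq_bigr (fun=> u)) => [|a _].
    by rewrite sumr_const -scaler_nat scalerA mulVf// scale1r.
  by rewrite pid ?phiKV//; apply: UG.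
have qphi b v : q (phi b v) = phi b (q v).
  rewrite /q [RHS]linearZ /=; congr (_ *: _)%R; rewrite [RHS]linear_sum /=.
  rewrite (reindex_inj (@gyradd_inj G b)); apply: eq_bigr => a _ /=.
  have /= -> := gyro_reprD phi b a; congr (phi b (phi a (p _))).
  (* Applying [phi (gyradd b a)] to both sides leaves [phi b v] on each, so no formula for
     [inv (gyradd b a)] is called for. *)
  apply: (@gyro_repr_inj _ _ _ phi (gyradd b a)); rewrite phiKV.
  by have -> := gyro_reprD phi b a; rewrite /= phiKV.
have q0 : q 0%R = 0%R by apply: qid; apply: subspace0.
exists [set v | q v = 0%R]%classic; split; [split|split].
- by apply/subspaceP; split=> //= a u v qu qv; rewrite qlin qu qv scaler0 addr0.
- by move=> b _ [v qv <-]; rewrite /= qphi qv linear0.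
(* Since [q v] lies in [U], [q] fixes it, so [q] kills [v - q v]. *)
- apply/seteqP; split=> // v _; exists (q v) => //; exists (v - q v)%R => /=.
    by rewrite addrC -scaleN1r qlin (qid (q v))// scaleN1r addNr.
  by rewrite addrC subrK.
- apply/seteqP; split=> [u [Uu qu]|_ ->]; first by rewrite /= -(qid u Uu).
  by split; [apply: subspace0|].
Qed.
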